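(* Let $n\ge 0$ be an integer. Let $T^n$ and $\widetilde{T}^n$ be the $(n+1)\times(n+1)$ Toeplitz matrices given, for $0\le i,j\le n$, by $$T^n_{ij} = (-1)^{i-j}\binom{n+1}{i-j}^2 \qquad\text{and}\qquad \widetilde{T}^n_{ij} = (i-j)\,T^n_{ij},$$ and let $H^n$ and $\widetilde{H}^n$ be the $(n+1)\times(n+1)$ Hankel matrices given, for $0\le i,j\le n$, by $$H^n_{ij} = (-1)^{i+j+1}\binom{n+1}{i+j+1}^2 \qquad\text{and}\qquad \widetilde{H}^n_{ij} = (i+j+1)\,H^n_{ij}.$$ Then $$\left(M^n\right)^{-1} = \left(\Delta^n\right)^{-1}\left[\widetilde{T}^n H^n - T^n\widetilde{H}^n\right]\left(\Delta^n\right)^{-1}.$$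
   Context: Matrix indices run from $0$ to $n$. Convention: $\binom{m}{k}=0$ if $k<0$ or $k>m$. The Bernstein polynomials are $B^n_i(x)=\binom{n}{i}x^i(1-x)^{n-i}$, $0\le i\le n$. The Bernstein mass matrix $M^n$ is the $(n+1)\times(n+1)$ matrix with entries $M^n_{ij}=\int_0^1 B^n_i(x)B^n_j(x)\,dx = \binom{n}{i}\binom{n}{j}\frac{(2n-i-j)!\,(i+j)!}{(2n+1)!}$. The matrix $\Delta^n$ is the $(n+1)\times(n+1)$ diagonal matrix with $\Delta^n_{ii}=\binom{n}{i}$. *)

(* Defs.v *)
From HB Require Import structures.
From mathcomp Require Import all_boot all_order all_algebra.
From mathcomp Require Import all_classical all_reals all_analysis.

Set Implicit Arguments.
Unset Strict Implicit.
Unset Printing Implicit Defensive.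

Import Order.TTheory GRing.Theory Num.Theory.

Local Open Scope ring_scope.

(* 'C(m, k) already vanishes for k > m; it is extended by 0 to k < 0, which
   the truncated difference of natural numbers would not do. *)
Definition binz (m : nat) (k : int) : nat :=
  match k with
  | Posz k' => 'C(m, k')
  | Negz _ => 0%N
  end.

Definition bernstein (R : realType) (n i : nat) (x : R) : R :=
  'C(n, i)%:R * x ^+ i * (1 - x) ^+ (n - i).

Definition bernstein_mass (R : realType) (n : nat) : 'M[R]_n.+1 :=
  \matrix_(i, j)
    \int[lebesgue_measure]_(x in `[0, 1]%classic)
      (bernstein n i x * bernstein n j x).

Definition binomial_diag (R : realType) (n : nat) : 'M[R]_n.+1 :=
  diag_mx (\row_(i < n.+1) 'C(n, i)%:R).

Definition toeplitzT (R : realType) (n : nat) : 'M[R]_n.+1 :=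
  \matrix_(i, j)
    ((-1) ^ (i%:Z - j%:Z) * (binz n.+1 (i%:Z - j%:Z))%:R ^+ 2).

Definition toeplitzTt (R : realType) (n : nat) : 'M[R]_n.+1 :=
  \matrix_(i, j) ((i%:Z - j%:Z)%:~R * toeplitzT R n i j).

Definition hankelH (R : realType) (n : nat) : 'M[R]_n.+1 :=
  \matrix_(i, j) ((-1) ^+ (i + j + 1) * 'C(n.+1, i + j + 1)%:R ^+ 2).

Definition hankelHt (R : realType) (n : nat) : 'M[R]_n.+1 :=
  \matrix_(i, j) ((i + j + 1)%:R * hankelH R n i j).

(* invmx is the identity on singular matrices, so its use on this matrix in
   the theorem is meaningful only thanks to this fact. *)
Lemma binomial_diag_unit (R : realType) (n : nat) :
  binomial_diag R n \in unitmx.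
Proof.
rewrite unitmxE det_diag unitfE; apply/prodf_neq0 => i _.
by rewrite mxE pnatr_eq0 -lt0n bin_gt0 -ltnS.
Qed.

(* Main.v *)
Require Import Defs.
From mathcomp Require Import all_boot all_order all_algebra.
From mathcomp Require Import all_classical all_reals all_analysis.
From mathcomp Require Import ring zify.

Set Implicit Arguments.
Unset Strict Implicit.
Unset Printing Implicit Defensive.

Import Order.TTheory GRing.Theory Num.Theory.
Local Open Scope ring_scope.

(** The Beta integral gives M = Delta K Delta, where K is the Hankel matrix of
    the moments h_k = k! (2n - k)! / (2n + 1)!, and the claim is that the
    bracket in the formula is the inverse of K.

    With c_m = (-1)^m C(n+1, m)^2 and D_ab = (a - b) c_a c_b, the bracket has
    entries B_ij = sum_k D_(i-k, k+j+1): it is the Bezout matrix of the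
    polynomials p(z) = sum_m c_m z^m and z p'(z), both of degree at most n + 1,
    i.e. (y - x) B(x, y) = D(x, y).  Let L be the linear functional
    z^k |-> h_k, applied in the variable y.  The entries of B K are the
    coefficients of S_l(x) = L(y^l B(x, y)), so that B K = 1 means
    S_l(x) = x^l for l <= n.

    Two facts give this.  First, L(y^s p) = L(y^s y p') = 0 for s < n: up to
    a constant, c_b h_(b+s) is (-1)^b C(n+1, b) times a polynomial in b of
    degree n - 1, so these are finite differences of order n + 1 of polynomials
    of degree at most n.  Applying L to y^s (y - x) B = y^s D thus gives
    S_(s+1) = x S_s, hence S_l = x^l S_0 for l <= n; as S_n = x^n S_0 has
    degree at most n, S_0 is a constant.  Second, this constant is
    S_0(0) = - L(p') = 1, once more by a finite difference of order n + 1, of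
    which only the term of index 0 is not part of L(p').

    [bezout_coef_inverse] is the argument on S_l, [sum_alt_bin_poly] the
    vanishing of finite differences, [alt_bin_bezout_orthogonal] and
    [alt_bin_bezout_normalized] the two facts about L. *)

(** * Bezout matrices and Hankel inverses *)

(** The coefficient of x^i y^j in D(x, y) / (y - x), where D(x, y) is the
    generating series of [D]. *)
Definition bezout_coef (R : nzRingType) (D : nat -> nat -> R) (i j : nat) : R :=
  \sum_(k < i.+1) D (i - k)%N (k + j).+1.

Lemma bezout_coef0 (R : nzRingType) (D : nat -> nat -> R) (j : nat) :
  bezout_coef D 0 j = D 0%N j.+1.
Proof. by rewrite /bezout_coef big_ord_recl big_ord0 addr0. Qed.

Lemma bezout_coefS (R : nzRingType) (D : nat -> nat -> R) (i j : nat) :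
  bezout_coef D i.+1 j = bezout_coef D i j.+1 + D i.+1 j.+1.
Proof.
rewrite /bezout_coef big_ord_recl addrC; congr (_ + _).
apply: eq_bigr => k _; rewrite /= /bump /=.
by rewrite add1n subSS addSnnS.
Qed.

(** D(x, y) / (y - x) is symmetric when D is alternating.  The recurrence
    [bezout_coefS] moves both indices one step towards the diagonal, so the
    proof goes by induction on their distance, in steps of 2; requiring
    [D a a = 0] settles distance 1 in any characteristic. *)
Lemma bezout_coef_sym (R : nzRingType) (D : nat -> nat -> R) (i j : nat) :
  (forall a b, D a b = - D b a) -> (forall a, D a a = 0) ->
  bezout_coef D i j = bezout_coef D j i.
Proof.
move=> DN D0.
have diag d : forall k, bezout_coef D (k + d)%N k = bezout_coef D k (k + d)%N.
  elim/ltn_ind: d => -[|[|d]] IHd k.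
  - by rewrite addn0.
  - by rewrite addn1 bezout_coefS D0 addr0.
  - have -> : (k + d.+2 = (k.+1 + d).+1)%N by lia.
    rewrite bezout_coefS IHd ?ltnS ?leqnSn // bezout_coefS [D k.+1 _]DN.
    by rewrite addrAC addrK.
by case: (leqP i j) => [|/ltnW] /subnKC <-.
Qed.

(** A Bezout matrix inverts the Hankel matrix of a functional that is
    orthogonal to y^s D(x, y) for s < n.  In terms of the row-wise
    generating functions S_l of the product, orthogonality gives
    S_(l+1) = x S_l, and boundedness of degrees forces S_0 to be constant. *)
Theorem bezout_coef_inverse (R : nzRingType) (n : nat)
    (D : nat -> nat -> R) (h : nat -> R) (i l : nat) :
  (forall a b, D a b = - D b a) -> (forall a, D a a = 0) ->
  (forall a b, (n.+1 < b)%N -> D a b = 0) ->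
  (forall a s, (s < n)%N -> \sum_(b < n.+2) D a b * h (b + s)%N = 0) ->
  \sum_(b < n.+1) D 0%N b.+1 * h b = 1 ->
  (i <= n)%N -> (l <= n)%N ->
  \sum_(j < n.+1) bezout_coef D i j * h (j + l)%N = (i == l)%:R.
Proof.
move=> DN D0 Dbnd orth norm.
pose S p s := \sum_(j < n.+1) bezout_coef D p j * h (j + s)%N.
have bnd p : bezout_coef D p n.+1 = 0.
  by rewrite /bezout_coef big1 // => k _; rewrite Dbnd // ltnS leq_addl.
have shift p s : (s < n)%N -> S p.+1 s.+1 = S p s.
  move=> sn; rewrite /S.
  (* The recurrence produces row p + 1 of D without its entry D (p + 1) 0; by
     orthogonality and symmetry, that entry is exactly the column-0 term which
     the reindexed row p of the Bezout matrix lacks. *)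
  have := orth p.+1 s sn.
  rewrite big_ord_recl /= add0n => /(canRL (addKr _)); rewrite addr0 => orthS.
  transitivity (\sum_(j < n.+2) bezout_coef D p j * h (j + s)%N);
    last by rewrite big_ord_recr /= bnd mul0r addr0.
  rewrite [RHS]big_ord_recl /= add0n (bezout_coef_sym p 0%N DN D0).
  rewrite bezout_coef0 DN.
  rewrite mulNr -orthS addrC -big_split; apply: eq_bigr => j _ /=.
  by rewrite /bump /= add1n bezout_coefS mulrDl addSnnS.
have S0 s : (s < n)%N -> S 0%N s.+1 = 0.
  move=> sn; rewrite -(orth 0%N s sn) big_ord_recl /= D0 mul0r add0r.
  by apply: eq_bigr => j _; rewrite bezout_coef0 /= /bump /= add1n addSnnS.
have iter_shift p d : (d <= n)%N -> S (p + d)%N d = S p 0%N.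
  by elim: d => [|d IHd] dn; rewrite ?addn0 // addnS shift // IHd // ltnW.
move=> le_in ln.
rewrite -/(S i l); elim: l i ln le_in => [|l IHl] [|i] ln le_in.
- by rewrite /S -[RHS]norm; apply: eq_bigr => j _; rewrite bezout_coef0 addn0.
(* Shifting column 0 along its diagonal ends in row n + 1, which is zero. *)
- rewrite -(iter_shift _ (n - i)%N) ?leq_subr // addSn subnKC; last exact: ltnW.
  by rewrite /S big1 // => j _; rewrite (bezout_coef_sym _ _ DN D0) bnd mul0r.
- by rewrite S0.
- by rewrite shift // IHl ?eqSS // ltnW.
Qed.

(** * Finite differences of polynomials *)

(** The N-th finite difference kills polynomials of degree below N.  Writing
    the polynomial as p X + c, the constant contributes (1 - 1)^N, and
    absorbing the factor m of m p(m) into the binomial coefficient leaves a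
    difference of order N - 1 of p(X + 1). *)
Lemma sum_alt_bin_poly (R : idomainType) (N : nat) (p : {poly R}) :
  (size p <= N)%N ->
  \sum_(m < N.+1) (-1) ^+ m * 'C(N, m)%:R * p.[m%:R] = 0.
Proof.
elim: N p => [|N IHN] p.
  rewrite leqn0 size_poly_eq0 => /eqP ->.
  by rewrite big1 // => m _; rewrite horner0 mulr0.
elim/poly_ind: p => [|p c _] size_p.
  by rewrite big1 // => m _; rewrite horner0 mulr0.
have {}size_p : (size p <= N)%N.
  move: size_p; rewrite size_MXaddC; case: eqP => [-> _|_ /=]; last by lia.
  by rewrite size_poly0.
have alt0 : \sum_(m < N.+2) (-1) ^+ m * 'C(N.+1, m)%:R = 0 :> R.
  transitivity ((1 - 1 : R) ^+ N.+1); last by rewrite subrr expr0n.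
  rewrite exprBn; apply: eq_bigr => m _.
  by rewrite !expr1n !mulr1 mulr_natr.
under eq_bigr => m _ do rewrite hornerMXaddC mulrDr.
rewrite big_split /= -mulr_suml alt0 mul0r addr0 big_ord_recl mulr0 mulr0 add0r.
have /IHN : (size (p \Po ('X + 1%:P)) <= N)%N.
  by rewrite size_comp_poly2 // size_XaddC.
move/(congr1 (fun x => - (N.+1%:R * x))); rewrite mulr0 oppr0 => shifted0.
rewrite -[RHS]shifted0 mulr_sumr -sumrN; apply: eq_bigr => m _.
rewrite /= /bump /= add1n horner_comp hornerD hornerX hornerC.
rewrite -natr1 -[LHS]mulrA.
have -> : 'C(N.+1, m.+1)%:R * (p.[m%:R + 1] * (m%:R + 1)) =
          N.+1%:R * 'C(N, m)%:R * p.[m%:R + 1] :> R.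
  by rewrite [m%:R + 1]natr1 mulrCA -!natrM mulnC -mul_bin_diag mulrC.
by rewrite exprS; ring.
Qed.

Definition poly_ffact (R : comNzRingType) (k : nat) : {poly R} :=
  \prod_(t < k) ('X - t%:R%:P).

Lemma size_poly_ffact (R : comNzRingType) (k : nat) :
  size (poly_ffact R k) = k.+1.
Proof.
rewrite /poly_ffact -(big_mkord xpredT (fun t => 'X - t%:R%:P)).
by rewrite size_prod_XsubC size_iota subn0.
Qed.

Lemma horner_poly_ffact (R : comNzRingType) (k m : nat) :
  (poly_ffact R k).[m%:R] = (m ^_ k)%:R.
Proof.
rewrite horner_prod ffact_prod; under eq_bigr => t _ do rewrite hornerXsubC.
have [le_km|lt_mk] := leqP k m.
  rewrite natr_prod; apply: eq_bigr => t _.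
  by rewrite natrB // ltnW // (leq_trans _ le_km).
rewrite (bigD1 (Ordinal lt_mk)) //= subrr mul0r.
by rewrite (bigD1 (Ordinal lt_mk)) //= subnn mul0n.
Qed.

(** * The Hankel matrix of Bernstein moments *)

Section Bernstein.

Variables (R : numFieldType) (n : nat).

Definition alt_bin_sqr (m : nat) : R := (-1) ^+ m * 'C(n.+1, m)%:R ^+ 2.

(** The integral of x^k (1 - x)^(2n - k) over [0, 1]. *)
Definition mass_moment (k : nat) : R :=
  (k`! * (2 * n - k)`!)%:R / (2 * n).+1`!%:R.

Definition alt_bin_bezout (a b : nat) : R :=
  (a%:R - b%:R) * (alt_bin_sqr a * alt_bin_sqr b).

(** One factor C(n+1, b) combines with the factorials of the moment into
    (n+1)! times two falling factorials, of lengths s and n - 1 - s, which are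
    polynomials in b; the other factor makes the sum a finite difference. *)
Lemma alt_bin_sqr_orthogonal (q : {poly R}) (s : nat) :
  (size q <= 2)%N -> (s < n)%N ->
  \sum_(b < n.+2) q.[b%:R] * alt_bin_sqr b * mass_moment (b + s) = 0.
Proof.
move=> size_q sn.
pose p := (poly_ffact R s \Po ('X + s%:R%:P)) *
          (poly_ffact R (n.-1 - s) \Po ((2 * n - s)%:R%:P - 'X)).
have size_p : (size (q * p)%R <= n.+1)%N.
  apply: leq_trans (size_polyMleq _ _) _.
  suff size_p : (size p <= n)%N.
    by rewrite -subn1 leq_subLR (leq_add size_q size_p).
  apply: leq_trans (size_polyMleq _ _) _.
  rewrite !size_comp_poly2 ?size_poly_ffact ?size_XaddC //; first by lia.
  by rewrite -[_ - _]opprB size_polyN size_XsubC.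
move/sum_alt_bin_poly: size_p.
move/(congr1 (fun x => (n.+1)`!%:R / (2 * n).+1`!%:R * x)).
rewrite mulr0 => sum0; rewrite -[RHS]sum0 mulr_sumr; apply: eq_bigr => b _.
have le_bn : (b <= n.+1)%N by rewrite -ltnS.
rewrite /alt_bin_sqr /mass_moment /p.
rewrite !(hornerM, horner_comp, hornerD, hornerN, hornerX, hornerC).
rewrite -natrD -natrB; last by lia.
rewrite !horner_poly_ffact.
have moment_bin : ((b + s)`! * (2 * n - (b + s))`!)%:R * 'C(n.+1, b)%:R =
  (n.+1)`!%:R * (((b + s) ^_ s)%:R * ((2 * n - s - b) ^_ (n.-1 - s))%:R) :> R.
  rewrite -!natrM; congr (_%:R).
  rewrite -(ffact_fact (leq_addl b s)) addnK subnDA [(2 * n - b - s)%N]subnAC.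
  rewrite -(@ffact_fact (2 * n - s - b) (n.-1 - s)); last by lia.
  have -> : (2 * n - s - b - (n.-1 - s) = n.+1 - b)%N by lia.
  by rewrite -(bin_fact le_bn); nia.
transitivity (q.[b%:R] * (-1) ^+ b * 'C(n.+1, b)%:R / (2 * n).+1`!%:R *
  (((b + s)`! * (2 * n - (b + s))`!)%:R * 'C(n.+1, b)%:R)); first by ring.
by rewrite moment_bin; ring.
Qed.

Lemma alt_bin_bezout_orthogonal (a s : nat) : (s < n)%N ->
  \sum_(b < n.+2) alt_bin_bezout a b * mass_moment (b + s) = 0.
Proof.
move=> sn; have size_q : (size (a%:R%:P - 'X : {poly R})%R <= 2)%N.
  by rewrite -[_ - _]opprB size_polyN size_XsubC.
have := alt_bin_sqr_orthogonal size_q sn.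
move/(congr1 (fun x => alt_bin_sqr a * x)); rewrite mulr0 => sum0.
rewrite -[RHS]sum0 mulr_sumr; apply: eq_bigr => b _.
by rewrite hornerD hornerN hornerC hornerX /alt_bin_bezout; ring.
Qed.

(** The (n+1)-th finite difference of m |-> (2n + 1 - m)! / (n + 1 - m)!,
    a polynomial of degree n, is zero.  Scaled by (n+1)! / (2n+1)!, its term of
    index 0 is 1 and the others are the terms of the sum with opposite sign. *)
Lemma alt_bin_bezout_normalized :
  \sum_(b < n.+1) alt_bin_bezout 0 b.+1 * mass_moment b = 1.
Proof.
pose p := poly_ffact R n \Po ((2 * n).+1%:R%:P - 'X).
have size_p : (size p <= n.+1)%N.
  rewrite size_comp_poly2 ?size_poly_ffact //.
  by rewrite -[_ - _]opprB size_polyN size_XsubC.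
have p_nat m : (m <= n.+1)%N -> p.[m%:R] = (((2 * n).+1 - m) ^_ n)%:R.
  move=> le_mn; rewrite /p horner_comp hornerD hornerN hornerX hornerC.
  by rewrite -natrB ?horner_poly_ffact //; lia.
have fact_neq0 k : k`!%:R != 0 :> R by rewrite pnatr_eq0 -lt0n fact_gt0.
have p0 : (n.+1)`!%:R / (2 * n).+1`!%:R * p.[0%:R] = 1.
  rewrite p_nat // subn0 -(@ffact_fact (2 * n).+1 n); last by lia.
  have -> : ((2 * n).+1 - n = n.+1)%N by lia.
  have ffact_neq0 : ((2 * n).+1 ^_ n)%:R != 0 :> R.
    by rewrite pnatr_eq0 -lt0n ffact_gt0; lia.
  by rewrite natrM; field; rewrite fact_neq0 ffact_neq0.
have := sum_alt_bin_poly size_p.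
rewrite big_ord_recl /= bin0 expr0 !mul1r => /eqP; rewrite addr_eq0 => /eqP p0E.
rewrite -[RHS]p0 p0E mulrN -mulrN -sumrN mulr_sumr.
apply: eq_bigr => b _; have le_bn : (b < n.+1)%N by [].
rewrite /= /bump /= add1n p_nat // subSS.
have moment_bin : (b.+1 * (b`! * (2 * n - b)`!))%:R * 'C(n.+1, b.+1)%:R =
  (n.+1)`!%:R * ((2 * n - b) ^_ n)%:R :> R.
  rewrite -!natrM; congr (_%:R).
  rewrite -(@ffact_fact (2 * n - b) n); last by lia.
  have -> : (2 * n - b - n = n.+1 - b.+1)%N by lia.
  by rewrite -(bin_fact le_bn) factS; nia.
transitivity (- ((-1 : R) ^+ b.+1 * 'C(n.+1, b.+1)%:R / (2 * n).+1`!%:R *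
  ((b.+1 * (b`! * (2 * n - b)`!))%:R * 'C(n.+1, b.+1)%:R))).
  rewrite /alt_bin_bezout /alt_bin_sqr /mass_moment bin0 expr0 expr1n.
  by rewrite [in RHS]natrM; ring.
by rewrite moment_bin; ring.
Qed.

Lemma alt_bin_bezout_inverse (i l : nat) : (i <= n)%N -> (l <= n)%N ->
  \sum_(j < n.+1) bezout_coef alt_bin_bezout i j * mass_moment (j + l) =
    (i == l)%:R.
Proof.
apply: bezout_coef_inverse.
- by move=> a b; rewrite /alt_bin_bezout; ring.
- by move=> a; rewrite /alt_bin_bezout subrr mul0r.
- move=> a b lt_nb; rewrite /alt_bin_bezout /alt_bin_sqr (bin_small lt_nb).
  by rewrite mulr0n expr0n !mulr0.
- exact: alt_bin_bezout_orthogonal.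
- exact: alt_bin_bezout_normalized.
Qed.

End Bernstein.

(** * The mass matrix and its inverse *)

Lemma bernstein_massE (R : realType) (n : nat) :
  bernstein_mass R n =
    binomial_diag R n *m (\matrix_(i, j) mass_moment R n (i + j)) *m
    binomial_diag R n.
Proof.
rewrite /binomial_diag mul_diag_mx mul_mx_diag; apply/matrixP => i j.
rewrite !mxE.
have [le_in le_jn] : (i <= n)%N /\ (j <= n)%N by split; rewrite -ltnS.
under eq_Rintegral => x _.
  have -> : bernstein n i x * bernstein n j x =
    'C(n, i)%:R * 'C(n, j)%:R * XMonemX (i + j) (2 * n - (i + j)) x.
    rewrite /bernstein /XMonemX /unstable.onem.
    have -> : (2 * n - (i + j) = (n - i) + (n - j))%N by lia.
    by rewrite !exprD; ring.
  over.
rewrite RintegralZl //; last exact: integrable_XMonemX.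
rewrite Rintegral_mkcond.
have := @beta_fun_fact R (i + j) (2 * n - (i + j)); rewrite /beta_fun /= => ->.
rewrite /mass_moment subnKC; last by lia.
by ring.
Qed.

(** The weights i - k of the modified Toeplitz matrix and k + j + 1 of the
    modified Hankel matrix subtract to the factor a - b of [alt_bin_bezout];
    the Toeplitz matrices are lower triangular, which cuts the matrix product
    at k = i. *)
Lemma toeplitz_hankel_bezout (R : realType) (n : nat) :
  toeplitzTt R n *m hankelH R n - toeplitzT R n *m hankelHt R n =
    \matrix_(i, j) bezout_coef (alt_bin_bezout R n) i j.
Proof.
apply/matrixP => i j; rewrite !mxE -sumrB /bezout_coef.
rewrite (big_ord_widen n.+1
  (fun k => alt_bin_bezout R n (i - k) (k + j).+1)) ?ltn_ord //.
rewrite [RHS]big_mkcond; apply: eq_bigr => k _; rewrite !mxE ltnS.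
case: leqP => [le_ki|lt_ik]; last first.
  have -> : binz n.+1 (i%:Z - k%:Z) = 0%N.
    case E : (i%:Z - k%:Z) => [d|d] //; lia.
  by ring.
rewrite subzn // -!pmulrn -exprnP /alt_bin_bezout /alt_bin_sqr /binz /=.
by rewrite addn1; ring.
Qed.

Theorem theorem3p4 (R : realType) (n : nat) :
  bernstein_mass R n \in unitmx /\
  invmx (bernstein_mass R n) =
    invmx (binomial_diag R n) *m
    (toeplitzTt R n *m hankelH R n - toeplitzT R n *m hankelHt R n) *m
    invmx (binomial_diag R n).
Proof.
set V := invmx _ *m _ *m _.
suff VM : V *m bernstein_mass R n = 1%:M.
  have [_ M_unit] := mulmx1_unit VM; split=> //.
  by rewrite -[LHS]mul1mx -VM mulmxK.
rewrite /V toeplitz_hankel_bezout bernstein_massE !mulmxA.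
rewrite mulmxKV ?binomial_diag_unit // -[X in X *m _]mulmxA.
set BK := _ *m \matrix_(_, _) _.
have -> : BK = 1%:M.
  apply/matrixP => i l; rewrite !mxE.
  have le_n (k : 'I_n.+1) : (k <= n)%N by rewrite -ltnS.
  rewrite -(alt_bin_bezout_inverse R (le_n i) (le_n l)).
  by apply: eq_bigr => j _; rewrite !mxE.
by rewrite mulmx1 mulVmx ?binomial_diag_unit.
Qed.
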